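(* Consider the K-AVG algorithm (described in the context) run with a fixed stepsize $\gamma_n=\bar\gamma>0$ and a fixed batch size $B_n=\bar B$ for all $n$, where for some constant $0<\delta<1$, $$1\ \ge\ \frac{L^2\bar\gamma^2(K+1)(K-2)}{2}+L\bar\gamma K \qquad\text{and}\qquad 1-\delta\ \ge\ L^2\bar\gamma^2 .$$ Then for every $N\in\mathbb{N}$, $$\frac{1}{N}\,\mathbb{E}\sum_{j=1}^N\big\|\nabla F(\widetilde w_j)\big\|_2^2\ \le\ \frac{2\big(F(\widetilde w_1)-F^*\big)}{N(K-1+\delta)\bar\gamma}+\frac{LK\bar\gamma M}{\bar B(K-1+\delta)}\Big(\frac{K}{P}+\frac{L(2K-1)(K-1)\bar\gamma}{6}\Big).$$
   Context: Let $F:\mathbb{R}^d\to\mathbb{R}$ be continuously differentiable with $L$-Lipschitz gradient ($L>0$): $\|\nabla F(w)-\nabla F(w')\|_2\le L\|w-w'\|_2$ for all $w,w'$. Let $\xi$ be a random variable and $(w,\xi)\mapsto\nabla F(w;\xi)\in\mathbb{R}^d$ a stochastic gradient satisfying, for every fixed $w$, $\mathbb{E}_\xi\nabla F(w;\xi)=\nabla F(w)$ and $\mathbb{E}_\xi\|\nabla F(w;\xi)\|_2^2-\|\mathbb{E}_\xi\nabla F(w;\xi)\|_2^2\le M$ for a constant $M\ge0$. K-AVG algorithm with $P\ge1$ processors, delay $K\ge1$, stepsizes $\gamma_n>0$ and batch sizes $B_n\ge1$: start from a deterministic $\widetilde w_1\in\mathbb{R}^d$. For $n=1,2,\dots$: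 each processor $j=1,\dots,P$ sets $w^j_{n,0}=\widetilde w_n$ and for $k=1,\dots,K$ updates $w^j_{n,k}=w^j_{n,k-1}-\frac{\gamma_n}{B_n}\sum_{s=1}^{B_n}\nabla F(w^j_{n,k-1};\xi^j_{n,k,s})$; then $\widetilde w_{n+1}=\frac1P\sum_{j=1}^P w^j_{n,K}$. All samples $\xi^j_{n,k,s}$ (over all $n,j,k,s$) are i.i.d. copies of $\xi$. It is assumed that there is a scalar $F^*$ with $F\ge F^*$ on an open set containing all iterates (in particular $F(\widetilde w_n)\ge F^*$ for all $n$). $\mathbb{E}$ denotes total expectation over all samples. *)

(* Defs.v *)
From HB Require Import structures.
From mathcomp Require Import all_boot all_order all_algebra.
From mathcomp Require Import all_classical all_reals all_analysis.
Set Implicit Arguments. Unset Strict Implicit. Unset Printing Implicit Defensive.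
Import Order.TTheory GRing.Theory Num.Theory.
Import numFieldNormedType.Exports.
Local Open Scope classical_set_scope.
Local Open Scope ring_scope.

Section KAVG.
Variable R : realType.
Variable d : nat.

Definition dotv (u v : 'rV[R]_d) : R := \sum_(i < d) u 0 i * v 0 i.
Definition sqnorm (v : 'rV[R]_d) : R := \sum_(i < d) v 0 i ^+ 2.
Definition norm2 (v : 'rV[R]_d) : R := Num.sqrt (sqnorm v).

Definition Rd_borel := g_sigma_algebraType (@open 'rV[R]_d).

Definition mean_vec {dT} {T : measurableType dT} (mu : probability T R)
  (f : T -> 'rV[R]_d) : 'rV[R]_d :=
  \row_i fine (\int[mu]_t (f t 0 i)%:E).

Definition iid_with_law {dO dT} {O : measurableType dO} {T : measurableType dT}
  {I : eqType} (Pr : probability O R) (mu : probability T R) (X : I -> O -> T)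
  : Prop :=
  (forall i, measurable_fun setT (X i)) /\
  forall (s : seq I) (A : I -> set T), uniq s -> (forall i, measurable (A i)) ->
    Pr (\big[setI/setT]_(i <- s) (X i @^-1` A i)) = (\prod_(i <- s) mu (A i))%E.

(* K-AVG.  Sample index (n, j, k, s) = round n, processor j, local step k,
   batch element s (all 1-based). *)
Section Alg.
Context {T : Type}.
Variable G : 'rV[R]_d -> T -> 'rV[R]_d.
Variable xi : nat * nat * nat * nat -> T.    (* a realization of all samples *)

Fixpoint local_iter (g : R) (B : nat) (n j : nat) (w0 : 'rV[R]_d) (k : nat)
  : 'rV[R]_d :=
  match k with
  | 0 => w0
  | k'.+1 => let w := local_iter g B n j w0 k' in
             w - (g / B%:R) *: \sum_(1 <= s < B.+1) G w (xi (n, j, k'.+1, s))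
  end.

Variables (gamma : nat -> R) (Bs : nat -> nat) (P K : nat) (w1 : 'rV[R]_d).

(* kavg_aux m = \tilde w_{m+1} *)
Fixpoint kavg_aux (m : nat) : 'rV[R]_d :=
  match m with
  | 0 => w1
  | m'.+1 => let w := kavg_aux m' in
      (P%:R)^-1 *: \sum_(1 <= j < P.+1) local_iter (gamma m'.+1) (Bs m'.+1) m'.+1 j w K
  end.

(* \tilde w_n for n >= 1 *)
Definition kavg_w (n : nat) : 'rV[R]_d := kavg_aux n.-1.
End Alg.
End KAVG.

(* Main.v *)
Require Import Defs.
From HB Require Import structures.
From mathcomp Require Import all_boot all_order all_algebra.
From mathcomp Require Import all_classical all_reals all_analysis.
From mathcomp Require Import measurable_realfun ring lra.
Set Implicit Arguments.
Unset Strict Implicit.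
Unset Printing Implicit Defensive.
Import Order.TTheory GRing.Theory Num.Theory.
Import numFieldNormedType.Exports.
Local Open Scope classical_set_scope.
Local Open Scope ring_scope.

(** Write w for the n-th round iterate, u_jk for the k-th local iterate of processor
    j, and g_jk for the averaged stochastic gradient taken there.  The descent lemma
    gives F(w_{n+1}) <= F(w) + <grad F(w), D> + L/2 |D|^2, where D is -gamma/P times
    the sum of all g_jk.  Since u_jk is independent of the samples entering g_jk,
    E<grad F(w), g_jk> = E<grad F(w), grad F(u_jk)>, and polarization bounds this
    below by half of E|grad F(w)|^2 + E|grad F(u_jk)|^2 - L^2 E|u_jk - w|^2.  The drift
    E|u_jk - w|^2 is at most gamma^2 k times the sum over i < k of
    M/B + E|grad F(u_ji)|^2.  In E|D|^2, batches of different processors are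
    uncorrelated given the iterates, which yields the factor 1/P in front of the
    variance.  The first stepsize condition cancels all E|grad F(u_jk)|^2 with k > 0,
    the second one leaves the factor K - 1 + delta in front of E|grad F(w)|^2, and the
    resulting bounds telescope over the rounds. *)

(** * Euclidean inner product and norm on row vectors *)

Section Euclidean.
Context {R : realType} {d : nat}.
Implicit Types u v w x y : 'rV[R]_d.

Lemma dotvC u v : dotv u v = dotv v u.
Proof. by apply: eq_bigr => i _; rewrite mulrC. Qed.

Lemma dotvDl u v w : dotv (u + v) w = dotv u w + dotv v w.
Proof. by rewrite /dotv -big_split; apply: eq_bigr => i _; rewrite mxE mulrDl. Qed.

Lemma dotvZl a u w : dotv (a *: u) w = a * dotv u w.
Proof. by rewrite /dotv mulr_sumr; apply: eq_bigr => i _; rewrite mxE mulrA. Qed.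

Lemma dotvDr u v w : dotv w (u + v) = dotv w u + dotv w v.
Proof. by rewrite dotvC dotvDl !(dotvC w). Qed.

Lemma dotvZr a u w : dotv w (a *: u) = a * dotv w u.
Proof. by rewrite dotvC dotvZl (dotvC w). Qed.

Lemma dotvNl u w : dotv (- u) w = - dotv u w.
Proof. by rewrite -scaleN1r dotvZl mulN1r. Qed.

Lemma dotvNr u w : dotv w (- u) = - dotv w u.
Proof. by rewrite dotvC dotvNl dotvC. Qed.

Lemma dotv0 u : dotv u 0 = 0.
Proof. by rewrite -(scale0r (0 : 'rV[R]_d)) dotvZr mul0r. Qed.

Lemma dotvv u : dotv u u = sqnorm u.
Proof. by apply: eq_bigr => i _; rewrite expr2. Qed.

Lemma sqnorm_ge0 u : 0 <= sqnorm u.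
Proof. by apply: sumr_ge0 => i _; rewrite sqr_ge0. Qed.

Lemma norm2_ge0 u : 0 <= norm2 u.
Proof. exact: sqrtr_ge0. Qed.

Lemma norm2_sqr u : norm2 u ^+ 2 = sqnorm u.
Proof. by rewrite sqr_sqrtr ?sqnorm_ge0. Qed.

Lemma sqnormD u v : sqnorm (u + v) = sqnorm u + 2 * dotv u v + sqnorm v.
Proof. rewrite -!dotvv dotvDl !dotvDr (dotvC v u); ring. Qed.

Lemma sqnormB u v : sqnorm (u - v) = sqnorm u - 2 * dotv u v + sqnorm v.
Proof.
rewrite -!dotvv dotvDl !dotvDr !dotvNl !dotvNr (dotvC v u); ring.
Qed.

Lemma sqnormZ a u : sqnorm (a *: u) = a ^+ 2 * sqnorm u.
Proof. by rewrite -!dotvv dotvZl dotvZr expr2 mulrA. Qed.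

Lemma norm2Z a u : norm2 (a *: u) = `|a| * norm2 u.
Proof. by rewrite /norm2 sqnormZ sqrtrM ?sqr_ge0// sqrtr_sqr. Qed.

Lemma norm20 : norm2 (0 : 'rV[R]_d) = 0.
Proof. by rewrite /norm2 -dotvv dotv0 sqrtr0. Qed.

Lemma cauchy_schwarz u v : dotv u v <= norm2 u * norm2 v.
Proof.
have [|uv0] := leP (dotv u v) 0.
  by move/le_trans; apply; rewrite mulr_ge0 ?norm2_ge0.
rewrite -(@ler_pXn2r _ 2)// ?nnegrE ?mulr_ge0 ?norm2_ge0 ?(ltW uv0)//.
rewrite exprMn !norm2_sqr.
(* The squared norm of this vector is |v|^2 (|u|^2 |v|^2 - <u,v>^2), so dividing by |v|^2 > 0 gives
   the claim. *)
have := sqnorm_ge0 (sqnorm v *: u - dotv u v *: v).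
rewrite sqnormB dotvZl dotvZr !sqnormZ.
have [v0|v0] := eqVneq (sqnorm v) 0.
  (* If |v|^2 = 0 while <u,v> > 0, this multiple of v makes the squared norm equal to -|u|^2 - 2,
     which is absurd. *)
  have := sqnorm_ge0 (u - (sqnorm u + 1) / dotv u v *: v).
  rewrite sqnormB sqnormZ dotvZr v0 mulr0 addr0 divfK ?gt_eqF//.
  by have := sqnorm_ge0 u; lra.
have vp : 0 < sqnorm v by rewrite lt_neqAle eq_sym v0 sqnorm_ge0.
set a := sqnorm u; set b := sqnorm v; set c := dotv u v => h.
have {h}: 0 <= b * (a * b - c ^+ 2) by move: h; nra.
by rewrite pmulr_rge0// subr_ge0.
Qed.

Lemma coord_le_norm2 u i : `|u 0 i| <= norm2 u.
Proof.
rewrite -sqrtr_sqr ler_wsqrtr// /sqnorm (bigD1 i)//= lerDl.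
by apply: sumr_ge0 => j _; rewrite sqr_ge0.
Qed.

Lemma continuous_norm2 : continuous (@norm2 R d).
Proof.
have csq : continuous (@sqnorm R d).
  apply: continuous_big => [|i _]; first exact: add_continuous.
  move=> y; have cy : {for y, continuous (fun z : 'rV[R]_d => z 0 i)}.
    exact: coord_continuous.
  have -> : (fun z : 'rV[R]_d => z 0 i ^+ 2) =
      (fun z : 'rV[R]_d => z 0 i) \* (fun z : 'rV[R]_d => z 0 i).
    by apply/funext => z; rewrite expr2.
  exact: continuousM.
move=> x; apply: (@continuous_comp _ _ _ (@sqnorm R d)); first exact: csq.
exact: sqrt_continuous.
Qed.

End Euclidean.

(** * Functions with Lipschitz gradient *)

Section SmoothFunction.
Context {R : realType} {d : nat}.
Variables (F : 'rV[R]_d -> R) (gradF : 'rV[R]_d -> 'rV[R]_d) (L : R).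
Hypothesis hF : forall w, differentiable F w /\ forall h, 'd F w h = dotv (gradF w) h.
Hypothesis hL : forall w w', norm2 (gradF w - gradF w') <= L * norm2 (w - w').

Lemma is_derive_line x h t :
  is_derive t (1 : R) (fun s : R => F (x + s *: h)) (dotv (gradF (x + t *: h)) h).
Proof.
have [dF dFE] := hF (x + t *: h).
have E : (fun e : R => e^-1 *:
    (((fun s : R => F (x + s *: h)) \o shift t) (e *: 1) - F (x + t *: h))) =
  (fun e : R => e^-1 *:
    ((F \o shift (x + t *: h)) (e *: h) - F (x + t *: h))).
  apply/funext => e /=; congr (_ *: (F _ - _)).
  by rewrite -[e *: 1]/(e * 1) mulr1 scalerDl addrCA.
have dh : derivable F (x + t *: h) h by exact: diff_derivable.
apply: DeriveDef; first by rewrite /derivable E.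
by rewrite -dFE -deriveE// /derive E.
Qed.

Lemma descent_lemma x y :
  F y <= F x + dotv (gradF x) (y - x) + L / 2 * sqnorm (y - x).
Proof.
set h := y - x.
pose c := dotv (gradF x) h; pose q := L / 2 * sqnorm h.
(* For 0 < t < 1 the derivative of [phi], <grad F(x + th) - grad F(x), h> - L t |h|^2, is
   nonpositive by Cauchy-Schwarz and the Lipschitz bound, so [phi 1 <= phi 0], which is the
   claim. *)
pose psi : R -> R := c *: (id : R -> R) + q *: ((id : R -> R) ^+ 2).
pose phi : R -> R := (fun t : R => F (x + t *: h)) - psi.
have phiE t : phi t = F (x + t *: h) - (c * t + q * t ^+ 2) by [].
have dphi t : is_derive t (1 : R) phi (dotv (gradF (x + t *: h)) h - (c + q * (2 * t))).
  apply: is_deriveB; first exact: is_derive_line.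
  by apply: is_derive_eq; rewrite /GRing.scale/= expr1; ring.
have : phi 1 <= phi 0.
  apply: (@ler0_derive1_le_cc R phi 0 1).
  - by move=> t _; apply: ex_derive.
  - move=> t; rewrite in_itv/= => /andP[t0 t1].
    rewrite derive1E derive_val.
    have -> : dotv (gradF (x + t *: h)) h - (c + q * (2 * t)) =
        dotv (gradF (x + t *: h) - gradF x) h - L * t * sqnorm h.
      by rewrite dotvDl dotvNl /c /q; field.
    rewrite subr_le0; apply: (le_trans (cauchy_schwarz _ _)).
    rewrite -norm2_sqr expr2 mulrA ler_wpM2r ?norm2_ge0//.
    apply: (le_trans (hL _ _)).
    by rewrite addrAC subrr add0r norm2Z ger0_norm ?(ltW t0)// mulrA.
  - apply: continuous_subspaceT => t.
    by apply/differentiable_continuous/derivable1_diffP; apply: ex_derive.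
  - by rewrite in_itv/= lexx ler01.
  - by rewrite in_itv/= lexx ler01.
  - exact: ler01.
have -> : y = x + h by rewrite /h addrC subrK.
rewrite !phiE scale1r scale0r addr0 /c /q.
by lra.
Qed.

Lemma continuous_gradF_coord i : continuous (fun w => gradF w 0 i : R).
Proof.
move=> w; have Fw : Filter (nbhs w) by exact: nbhs_filter.
apply/cvgrPdist_le => e e0.
have c0 : (fun y : 'rV[R]_d => L * norm2 (w - y)) y @[y --> w] --> (0 : R).
  have -> : (0 : R) = L * norm2 (w - w).
    by rewrite subrr norm20 mulr0.
  apply: cvgM; first exact: cvg_cst.
  apply: (continuous_cvg _ (@continuous_norm2 R d _)).
  by apply: cvgB; [exact: cvg_cst | exact: cvg_id].
move/cvgrPdist_le : c0 => /(_ e e0); apply: filterS => y /=.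
rewrite sub0r normrN => h; apply: le_trans h.
apply: le_trans (ler_norm _); apply: le_trans (hL _ _).
by have := coord_le_norm2 (gradF w - gradF y) i; rewrite !mxE.
Qed.

End SmoothFunction.

(** * Borel measurability of vector-valued maps, coordinate by coordinate *)

Section BorelVectors.
Context {R : realType} {d : nat}.

(* Countably many such cubes form a base of the topology, so that a map with
   measurable coordinates is measurable for the Borel sigma-algebra. *)
Definition ratcube (p : 'rV[rat]_d * nat) : set 'rV[R]_d :=
  [set y | forall i : 'I_d, `|y 0 i - ratr (p.1 0 i)| < p.2.+1%:R^-1].

(** Balls are those of the sup norm: a rational centre within 1/(n+1) < e/2 of x in each coordinate
    gives a cube that contains x and stays in the ball of radius e. *)
Lemma open_bigcup_ratcube (U : set 'rV[R]_d) : open U ->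
  U = \bigcup_(p in [set p | ratcube p `<=` U]) ratcube p.
Proof.
move=> oU; apply/seteqP; split => [x Ux|x [p /= pU]]; last exact: pU.
have /nbhs_ballP[e /= e0 eU] : nbhs x U by move: oU; rewrite openE; apply.
have [n ne] : exists n, n.+1%:R^-1 < e / 2.
  have [n _ /(_ n (leqnn n))] := near_infty_natSinv_lt (PosNum (divr_gt0 e0 (ltr0Sn R 1))).
  by exists n.
have qx i : exists q : rat, `|x 0 i - ratr q| < n.+1%:R^-1.
  have n0 : (0 : R) < n.+1%:R^-1 by [].
  move: (n.+1%:R^-1 : R) n0 => a a0; move: (x 0 i : R) => r.
  have : r - a < r + a by lra.
  case/rat_in_itvoo => q; rewrite in_itv/= => /andP[q1 q2]; exists q.
  by rewrite ltr_norml; apply/andP; split; [move: q1|move: q2]; lra.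
exists (\row_i projT1 (cid (qx i)), n).
  move=> y /= yq; apply: eU; split=> // i j; rewrite ord1.
  have := yq j; rewrite mxE; case: (cid (qx j)) => /= q xq yqj.
  move: (x 0 j : R) (y 0 j : R) (n.+1%:R^-1 : R) (ratr q : R) ne xq yqj => r s a t ne.
  rewrite -ball_normE /ball_/= !ltr_norml.
  by move=> /andP[? ?] /andP[? ?]; apply/andP; split; lra.
by move=> i /=; rewrite mxE; case: (cid (qx i)).
Qed.

Lemma measurable_to_Rd_borel dS (S : measurableType dS) (W : S -> 'rV[R]_d) :
  (forall i, measurable_fun setT (fun s => W s 0 i)) ->
  measurable_fun setT (W : S -> Rd_borel R d).
Proof.
move=> mW; apply: (@measurability _ _ S (Rd_borel R d) setT W (@open 'rV[R]_d)) => //.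
(* The union is reindexed over all pairs, a countable type; cubes not inside U contribute the empty
   set. *)
move=> _ [U oU <-]; rewrite setTI (open_bigcup_ratcube oU) preimage_bigcup bigcup_mkcond.
apply: countable_bigcupT_measurable => [|p]; first exact: countableP.
case: ifP => _ //.
have -> : W @^-1` ratcube p =
    \bigcap_(i in [set: 'I_d]) (setT `&` (fun s => W s 0 i) @^-1`
       [set r | `|r - ratr (p.1 0 i)| < p.2.+1%:R^-1]).
  by apply/seteqP; split => [s /= h i _|s h i] //=; have [] := h i Logic.I.
apply: fin_bigcap_measurable => [|i _]; first exact: finite_finset.
apply: mW => //.
have -> : [set r : R | `|r - ratr (p.1 0 i)| < p.2.+1%:R^-1] =
   `](ratr (p.1 0 i) - p.2.+1%:R^-1), (ratr (p.1 0 i) + p.2.+1%:R^-1)[%classic.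
  apply/seteqP; split => r; rewrite /= in_itv/= ltr_norml;
    move: (ratr (p.1 0 i) : R) (p.2.+1%:R^-1 : R) => q e /andP[? ?];
    by apply/andP; split; lra.
exact: measurable_itv.
Qed.

Lemma measurable_continuous_Rd (f : 'rV[R]_d -> R) : continuous f ->
  measurable_fun setT (f : Rd_borel R d -> R).
Proof.
move=> cf; apply: (measurability _ (RGenOpens.measurableE R)) => //.
move=> _ [_ [a [b ->] <-]]; rewrite setTI.
by apply: sub_sigma_algebra; apply: open_comp => //; exact: interval_open.
Qed.

End BorelVectors.

(** * Square integrable random vectors *)

Section MeasurableVectors.
Context {R : realType} {d : nat} {dS : measure_display} {S : measurableType dS}.
Implicit Types X Y : S -> 'rV[R]_d.

Definition measurable_vec X := forall i, measurable_fun setT (fun s => X s 0 i : R).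

Lemma measurable_vec_cst v : measurable_vec (fun=> v).
Proof. by move=> i; exact: measurable_cst. Qed.

Lemma measurable_vecD X Y : measurable_vec X -> measurable_vec Y ->
  measurable_vec (fun s => X s + Y s).
Proof.
move=> mX mY i; under eq_fun do rewrite mxE.
by apply: measurable_funD; [exact: mX | exact: mY].
Qed.

Lemma measurable_vecZ a X : measurable_vec X -> measurable_vec (fun s => a *: X s).
Proof.
move=> mX i; under eq_fun do rewrite mxE.
by apply: measurable_funM; [exact: measurable_cst | exact: mX].
Qed.

Lemma measurable_vec_sum (I : Type) (r : seq I) (X : I -> S -> 'rV[R]_d) :
  (forall i, measurable_vec (X i)) -> measurable_vec (fun s => \sum_(i <- r) X i s).
Proof.
move=> mX i; under eq_fun do rewrite summxE.
by apply: measurable_sum => j; exact: mX.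
Qed.

Lemma measurable_dotv X Y : measurable_vec X -> measurable_vec Y ->
  measurable_fun setT (fun s => dotv (X s) (Y s)).
Proof.
move=> mX mY; apply: measurable_sum => i.
by apply: measurable_funM; [exact: mX | exact: mY].
Qed.

Lemma measurable_sqnorm X : measurable_vec X -> measurable_fun setT (fun s => sqnorm (X s)).
Proof.
by move=> mX; under eq_fun do rewrite -dotvv; exact: measurable_dotv.
Qed.

End MeasurableVectors.

Section SquareIntegrable.
Context {R : realType} {d : nat} {dO : measure_display} {O : measurableType dO}.
Variable Pr : probability O R.
Implicit Types X Y : O -> 'rV[R]_d.

Definition sq_integrable X :=
  measurable_vec X /\ Pr.-integrable setT (fun w => (sqnorm (X w))%:E).

(** The L^2 inner product E<X,Y>. A real integral is 0 by default when the extended one is infinite,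
    hence the [sq_integrable] hypotheses below. *)
Definition inner X Y : R := \int[Pr]_w dotv (X w) (Y w).

Lemma sq_integrable_le X (f : O -> R) : measurable_vec X ->
  Pr.-integrable setT (EFin \o f) -> (forall w, sqnorm (X w) <= f w) -> sq_integrable X.
Proof.
move=> mX fi Xf; split=> //; apply: le_integrable fi => //.
  by apply/measurable_EFinP; exact: measurable_sqnorm.
by move=> w _; rewrite /= lee_fin ger0_norm ?sqnorm_ge0// (le_trans (Xf w))// ler_norm.
Qed.

Lemma sq_integrableP X : measurable_vec X ->
  (\int[Pr]_w (sqnorm (X w))%:E < +oo)%E -> sq_integrable X.
Proof.
move=> mX fi; split=> //; apply/integrableP; split.
  by apply/measurable_EFinP; exact: measurable_sqnorm.
by under eq_integral do rewrite /= ger0_norm ?sqnorm_ge0//.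
Qed.

Lemma sq_integrable_cst v : sq_integrable (fun=> v).
Proof. by split; [exact: measurable_vec_cst | exact: finite_measure_integrable_cst]. Qed.

Lemma sq_integrableZ a X : sq_integrable X -> sq_integrable (fun w => a *: X w).
Proof.
move=> [mX iX]; split; first exact: measurable_vecZ.
under eq_fun do rewrite sqnormZ EFinM.
exact: integrableZl.
Qed.

Lemma sq_integrableD X Y : sq_integrable X -> sq_integrable Y ->
  sq_integrable (fun w => X w + Y w).
Proof.
move=> [mX iX] [mY iY].
apply: (@sq_integrable_le _ (fun w => 2 * sqnorm (X w) + 2 * sqnorm (Y w))).
- exact: measurable_vecD.
- apply: eq_integrable (integrableD _ (integrableZl _ 2 iX) (integrableZl _ 2 iY)) => //.
- move=> w; have := sqnorm_ge0 (X w - Y w); rewrite sqnormB sqnormD; lra.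
Qed.

Lemma sq_integrableB X Y : sq_integrable X -> sq_integrable Y ->
  sq_integrable (fun w => X w - Y w).
Proof.
move=> hX hY; under eq_fun do rewrite -scaleN1r.
by apply: sq_integrableD => //; exact: sq_integrableZ.
Qed.

Lemma sq_integrable_sum (I : eqType) (r : seq I) (X : I -> O -> 'rV[R]_d) :
  (forall i, i \in r -> sq_integrable (X i)) ->
  sq_integrable (fun w => \sum_(i <- r) X i w).
Proof.
elim: r => [|i r IH] hX.
  by under eq_fun do rewrite big_nil; exact: sq_integrable_cst.
under eq_fun do rewrite big_cons; apply: sq_integrableD.
  by apply: hX; rewrite mem_head.
by apply: IH => j jr; apply: hX; rewrite in_cons jr orbT.
Qed.

Lemma integrable_dotv X Y : sq_integrable X -> sq_integrable Y ->
  Pr.-integrable setT (EFin \o (fun w => dotv (X w) (Y w))).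
Proof.
move=> [mX iX] [mY iY].
apply: (@le_integrable _ _ _ _ _ _ _ (EFin \o (fun w => sqnorm (X w) + sqnorm (Y w)))) => //.
- by apply/measurable_EFinP; exact: measurable_dotv.
- move=> w _; rewrite /= lee_fin [leRHS]ger0_norm ?addr_ge0 ?sqnorm_ge0// ler_norml.
  (* Nonnegativity of |X - Y|^2 and |X + Y|^2 bounds 2|<X,Y>| by |X|^2 + |Y|^2. *)
  have := sqnorm_ge0 (X w - Y w); have := sqnorm_ge0 (X w + Y w); rewrite sqnormB sqnormD.
  by move=> ? ?; apply/andP; split; lra.
- exact: eq_integrable (integrableD _ iX iY).
Qed.

Lemma innerC X Y : inner X Y = inner Y X.
Proof. by apply: eq_Rintegral => w _; rewrite dotvC. Qed.

Lemma innerDl X Y Z : sq_integrable X -> sq_integrable Y -> sq_integrable Z ->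
  inner (fun w => X w + Y w) Z = inner X Z + inner Y Z.
Proof.
move=> hX hY hZ; rewrite /inner -RintegralD//; try exact: integrable_dotv.
by apply: eq_Rintegral => w _; rewrite dotvDl.
Qed.

Lemma innerZl a X Z : sq_integrable X -> sq_integrable Z ->
  inner (fun w => a *: X w) Z = a * inner X Z.
Proof.
move=> hX hZ; rewrite /inner -RintegralZl//; last exact: integrable_dotv.
by apply: eq_Rintegral => w _; rewrite dotvZl.
Qed.

Lemma innerDr X Y Z : sq_integrable X -> sq_integrable Y -> sq_integrable Z ->
  inner Z (fun w => X w + Y w) = inner Z X + inner Z Y.
Proof. by move=> hX hY hZ; rewrite innerC innerDl// !(innerC Z). Qed.

Lemma innerZr a X Z : sq_integrable X -> sq_integrable Z ->
  inner Z (fun w => a *: X w) = a * inner Z X.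
Proof. by move=> hX hZ; rewrite innerC innerZl// (innerC Z). Qed.

Lemma inner_suml (I : eqType) (r : seq I) (X : I -> O -> 'rV[R]_d) Z :
  (forall i, i \in r -> sq_integrable (X i)) -> sq_integrable Z ->
  inner (fun w => \sum_(i <- r) X i w) Z = \sum_(i <- r) inner (X i) Z.
Proof.
move=> hX hZ; elim: r hX => [|i r IH] hX.
  rewrite big_nil; under [X in inner X]eq_fun do rewrite big_nil.
  rewrite -(mul0r (inner Z Z)) -innerZl//; congr inner.
  by apply/funext => w; rewrite scale0r.
have hr j : j \in r -> sq_integrable (X j) by move=> jr; apply: hX; rewrite in_cons jr orbT.
rewrite big_cons -IH// -innerDl//.
- by congr inner; apply/funext => w; rewrite big_cons.
- by apply: hX; rewrite mem_head.
- exact: sq_integrable_sum.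
Qed.

Lemma inner_sumr (I : eqType) (r : seq I) (X : I -> O -> 'rV[R]_d) Z :
  (forall i, i \in r -> sq_integrable (X i)) -> sq_integrable Z ->
  inner Z (fun w => \sum_(i <- r) X i w) = \sum_(i <- r) inner Z (X i).
Proof. by move=> hX hZ; rewrite innerC inner_suml//; apply: eq_bigr => i _; exact: innerC. Qed.

Lemma integrable_sum_dotv (I : eqType) (r : seq I) (X Y : I -> O -> 'rV[R]_d) :
  (forall i, i \in r -> sq_integrable (X i)) -> (forall i, i \in r -> sq_integrable (Y i)) ->
  Pr.-integrable setT (EFin \o (fun w => \sum_(i <- r) dotv (X i w) (Y i w))).
Proof.
move=> hX hY; rewrite (_ : _ \o _ = fun w => \sum_(i <- r | i \in r) (dotv (X i w) (Y i w))%:E)%E.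
  by apply: integrable_sum => // i ir; apply: integrable_dotv; [exact: hX | exact: hY].
by apply/funext => w; rewrite /= -sumEFin big_seq.
Qed.

Lemma Rintegral_sum_dotv (I : eqType) (r : seq I) (X Y : I -> O -> 'rV[R]_d) :
  (forall i, i \in r -> sq_integrable (X i)) -> (forall i, i \in r -> sq_integrable (Y i)) ->
  \int[Pr]_w (\sum_(i <- r) dotv (X i w) (Y i w)) = \sum_(i <- r) inner (X i) (Y i).
Proof.
elim: r => [|i r IH] hX hY.
  rewrite big_nil; under eq_Rintegral do rewrite big_nil.
  by rewrite Rintegral_cst// mul0r.
have hXr j : j \in r -> sq_integrable (X j) by move=> jr; apply: hX; rewrite in_cons jr orbT.
have hYr j : j \in r -> sq_integrable (Y j) by move=> jr; apply: hY; rewrite in_cons jr orbT.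
rewrite big_cons -IH//; under eq_Rintegral do rewrite big_cons.
rewrite RintegralD//; last exact: integrable_sum_dotv.
by apply: integrable_dotv; [apply: hX | apply: hY]; rewrite mem_head.
Qed.

Lemma inner_le X Y X' Y' : sq_integrable X -> sq_integrable Y ->
  sq_integrable X' -> sq_integrable Y' ->
  (forall w, dotv (X w) (Y w) <= dotv (X' w) (Y' w)) -> inner X Y <= inner X' Y'.
Proof. by move=> *; apply: le_Rintegral => //; exact: integrable_dotv. Qed.

Lemma inner_ge0 X : 0 <= inner X X.
Proof. by apply: Rintegral_ge0 => w _; rewrite dotvv sqnorm_ge0. Qed.

Lemma EFin_inner X : sq_integrable X -> (inner X X)%:E = (\int[Pr]_w (sqnorm (X w))%:E)%E.
Proof.
move=> [mX iX]; rewrite /inner /Rintegral.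
under eq_integral do rewrite dotvv.
by rewrite fineK//; exact: integrable_fin_num.
Qed.

Lemma innerB_sqr X Y : sq_integrable X -> sq_integrable Y ->
  inner (fun w => X w - Y w) (fun w => X w - Y w) =
  inner X X - 2 * inner X Y + inner Y Y.
Proof.
move=> hX hY; have hN := sq_integrableZ (-1) hY.
rewrite (_ : (fun w => X w - Y w) = fun w => X w + -1 *: Y w); last first.
  by apply/funext => w; rewrite scaleN1r.
rewrite innerDl//; last exact: sq_integrableD.
rewrite !innerDr// !innerZr// !innerZl// (innerC Y X); ring.
Qed.

Lemma innerZ_sqr b X : sq_integrable X ->
  inner (fun w => b *: X w) (fun w => b *: X w) = b ^+ 2 * inner X X.
Proof.
by move=> hX; rewrite innerZl ?innerZr ?mulrA ?expr2//; exact: sq_integrableZ.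
Qed.

Lemma inner_AMGM X Y : sq_integrable X -> sq_integrable Y ->
  2 * inner X Y <= inner X X + inner Y Y.
Proof.
move=> hX hY; have := inner_ge0 (fun w => X w - Y w).
by rewrite innerB_sqr//; lra.
Qed.

(** If the bound (a_i + a_j)/2 also held on the diagonal, the double sum would be at most [size r]
    times the sum of the [a i]; the diagonal excess [b i - a i] is added only once. With [b i - a i]
    a variance, this is the gain from averaging independent noise. *)
Lemma inner_sum_le (I : eqType) (r : seq I) (X : I -> O -> 'rV[R]_d) (a b : I -> R) :
  uniq r -> (forall i, i \in r -> sq_integrable (X i)) ->
  (forall i, i \in r -> inner (X i) (X i) <= b i) ->
  (forall i j, i \in r -> j \in r -> i != j -> inner (X i) (X j) <= (a i + a j) / 2) ->
  inner (fun w => \sum_(i <- r) X i w) (fun w => \sum_(i <- r) X i w) <=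
  \sum_(i <- r) (b i - a i) + (size r)%:R * \sum_(i <- r) a i.
Proof.
move=> ur hX hb ha; rewrite inner_suml//; last exact: sq_integrable_sum.
have H i : i \in r -> inner (X i) (fun w => \sum_(j <- r) X j w) <=
    (b i - a i) + ((size r)%:R / 2 * a i + 2^-1 * \sum_(j <- r) a j).
  move=> ir; rewrite inner_sumr//; last exact: hX.
  (* Row i of the double sum, with the diagonal excess placed at j = i. *)
  have -> : (b i - a i) + ((size r)%:R / 2 * a i + 2^-1 * \sum_(j <- r) a j) =
      \sum_(j <- r) ((if j == i then b i - a i else 0) + (a i + a j) / 2).
    have E : \sum_(j <- r) (if j == i then b i - a i else 0) = b i - a i.
      by rewrite (bigD1_seq i)//= eqxx big1 ?addr0// => j /negPf ->.
    rewrite big_split/= E; congr (_ + _).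
    rewrite -mulr_suml big_split/= big_const_seq count_predT iter_addr_0.
    by rewrite -(mulr_natl (a i)); field.
  rewrite big_seq [leRHS]big_seq; apply: ler_sum => j jr.
  case: eqVneq => [->|ji]; last by rewrite add0r ha// eq_sym.
  by have := hb i ir; lra.
apply: (@le_trans _ _ (\sum_(i <- r) ((b i - a i) +
    ((size r)%:R / 2 * a i + 2^-1 * \sum_(j <- r) a j)))).
  by rewrite big_seq [leRHS]big_seq; apply: ler_sum.
rewrite !big_split/= -mulr_sumr big_const_seq count_predT iter_addr_0.
by rewrite -(mulr_natl (_ * _)) le_eqVlt; apply/orP; left; apply/eqP; field.
Qed.

(** Cauchy-Schwarz for sums: the case [a = b] of [inner_sum_le], where AM-GM bounds the cross
    terms. *)
Lemma inner_sum_le_size (I : eqType) (r : seq I) (X : I -> O -> 'rV[R]_d) :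
  uniq r -> (forall i, i \in r -> sq_integrable (X i)) ->
  inner (fun w => \sum_(i <- r) X i w) (fun w => \sum_(i <- r) X i w) <=
  (size r)%:R * \sum_(i <- r) inner (X i) (X i).
Proof.
move=> ur hX.
apply: (le_trans (@inner_sum_le _ r X (fun i => inner (X i) (X i))
  (fun i => inner (X i) (X i)) ur hX _ _)) => //.
  by move=> i j ir jr _; have := inner_AMGM (hX i ir) (hX j jr); lra.
by rewrite big1 ?add0r// => i _; rewrite subrr.
Qed.

End SquareIntegrable.

(** * Independence of one sample from the others *)

Section JointLaw.
Context {R : realType} {dO dS dT : measure_display}.
Context {O : measurableType dO} {S : measurableType dS} {T : measurableType dT}.
Variables (Pr : probability O R) (mu : probability T R).
Variables (Y : {mfun O >-> S}) (X : {mfun O >-> T}).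
Hypothesis YX : forall A B, measurable A -> measurable B ->
  Pr (Y @^-1` A `&` X @^-1` B) = (Pr (Y @^-1` A) * mu B)%E.

Let YXfun (w : O) : S * T := (Y w, X w).

Let measurable_YX : measurable_fun setT YXfun.
Proof. by apply: measurable_fun_pair. Qed.

(** [YX] makes the joint law of (Y, X) agree on rectangles with the product of the law of Y and
    [mu], and a product measure is determined by its values there. *)
Lemma integral_joint_law (f : S * T -> \bar R) :
  (\int[pushforward Pr YXfun]_z f z = \int[distribution Pr Y \x mu]_z f z)%E.
Proof.
unshelve epose (m := pushforward Pr YXfun : {measure set (S * T)%type -> \bar R}).
  exact: measurable_YX.
rewrite -[X in integral X]/(m : set (S * T)%type -> \bar R).
apply: (@eq_measure_integral _ _ _ _ (distribution Pr Y \x mu)%E m) => A mA _.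
by apply/esym/product_measure_unique => // B C mB mC; rewrite -YX.
Qed.

Lemma ge0_integral_joint_law (f : S * T -> \bar R) :
  measurable_fun setT f -> (forall z, 0 <= f z)%E ->
  (\int[Pr]_w f (Y w, X w) = \int[Pr]_w \int[mu]_t f (Y w, t))%E.
Proof.
move=> mf f0.
have /= <- := @ge0_integral_pushforward _ _ _ _ _ YXfun measurable_YX Pr setT f
  measurableT mf (fun y _ => f0 y).
rewrite integral_joint_law fubini_tonelli1//.
rewrite ge0_integral_distribution//; first exact: measurable_fun_fubini_tonelli_F.
by move=> y; exact: integral_ge0.
Qed.

Lemma integral_joint_law_integrable (f : S * T -> \bar R) :
  measurable_fun setT f -> Pr.-integrable setT (fun w => f (Y w, X w)) ->
  (\int[Pr]_w f (Y w, X w) = \int[Pr]_w \int[mu]_t f (Y w, t))%E.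
Proof.
move=> mf fi.
(* The pushforward identity for |f| carries integrability over to the product measure, so that
   Fubini applies. *)
have mF : (distribution Pr Y \x mu)%E.-integrable setT f.
  apply/integrableP; split=> //.
  rewrite -integral_joint_law ge0_integral_pushforward//; last first.
    exact: measurableT_comp.
  by case/integrableP : fi.
have /= <- := @integral_pushforward _ _ _ _ _ YXfun measurable_YX Pr setT f
  mf fi measurableT.
rewrite integral_joint_law -integral12_prod_meas1//.
rewrite integral_distribution//; first exact: measurable_fubini_F mF.
have /integrableP[mFub] := integrable_fubini_F mF.
rewrite ge0_integral_distribution//; last exact: measurableT_comp.
by move=> FY; apply/integrableP; split=> //; exact: measurableT_comp.
Qed.

End JointLaw.

(** * The sigma-algebra of all samples but one *)

Section OtherSamples.
Context {R : realType} {I : choiceType} {dO dT : measure_display}.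
Context {O : measurableType dO} {T : measurableType dT}.
Variables (Pr : probability O R) (mu : probability T R) (X : I -> O -> T).
Hypothesis iidX : iid_with_law Pr mu X.
Variable i : I.

(** A pi-system: finitely many samples are constrained, none of them the i-th. The list may have
    repetitions, which is why [undup] appears below. *)
Definition cylinders_off : set (set O) :=
  [set A | exists (s : seq I) (B : I -> set T), [/\ i \notin s,
     forall j, measurable (B j) & A = [set w | forall j, j \in s -> B j (X j w)]]].

(* The sample space with the sigma-algebra generated by all samples except the
   i-th: a function measurable on [others] is independent of [X i]. *)
Definition others := g_sigma_algebraType cylinders_off.

Lemma measurable_others_sample j : j != i ->
  measurable_fun setT (X j : others -> T).
Proof.
move=> ji _ B mB; rewrite setTI; apply: sub_sigma_algebra.
exists [:: j], (fun=> B); split=> //; first by rewrite inE eq_sym.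
apply/seteqP; split => w /=; first by move=> Bw k; rewrite inE => /eqP ->.
by apply; rewrite inE.
Qed.

Lemma cylinder_big (s : seq I) (B : I -> set T) :
  [set w | forall j, j \in s -> B j (X j w)] =
  \big[setI/setT]_(j <- undup s) (X j @^-1` B j).
Proof.
rewrite -bigcap_seq; apply/seteqP; split => w /= h j.
  by rewrite /= mem_undup; exact: h.
by move=> js; apply: (h j); rewrite /= mem_undup.
Qed.

Lemma measurable_id_others : measurable_fun setT (id : O -> others).
Proof.
apply: (@measurability _ _ O others setT id cylinders_off) => //.
move=> _ [_ [s [B [_ mB ->]]] <-]; rewrite setTI cylinder_big.
apply: bigsetI_measurable => j _.
by rewrite -[X in measurable X]setTI; exact: iidX.1.
Qed.

Lemma setI_closed_cylinders_off : setI_closed cylinders_off.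
Proof.
move=> _ _ [s [B [si mB ->]]] [s' [B' [s'i mB' ->]]].
(* A constraint is replaced by [setT] outside its own list, so that one family serves both
   cylinders. *)
exists (s ++ s'), (fun j => (if j \in s then B j else setT) `&`
  (if j \in s' then B' j else setT)); split.
- by rewrite mem_cat negb_or si.
- by move=> j; apply: measurableI; case: ifP.
apply/seteqP; split => w /=.
  move=> [h h'] j _; split; first by case: ifP => // js; exact: h.
  by case: ifP => // js; exact: h'.
move=> h; split=> j js.
  by have [] := h j; rewrite ?mem_cat ?js.
by have [] := h j; rewrite ?mem_cat ?js ?orbT.
Qed.

(** Both sides are finite measures in A on [others]. They agree on cylinders by the product formula
    for the duplicate-free index lists with and without i, and a generating pi-system containing the
    whole space determines them. *)
Lemma others_indep (A : set others) (B : set T) : measurable A -> measurable B ->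
  Pr (A `&` X i @^-1` B) = (Pr A * mu B)%E.
Proof.
move=> mA mB.
have mXB : measurable (X i @^-1` B) by rewrite -[X in measurable X]setTI; exact: iidX.1.
have muBf : mu B \is a fin_num by exact: fin_num_measure.
unshelve epose (m1 :=
  pushforward (mrestr Pr mXB) (id : O -> others) : {measure set others -> \bar R}).
  exact: measurable_id_others.
unshelve epose (m2 := mscale (NngNum (fine_ge0 (measure_ge0 mu B)))
  (pushforward Pr (id : O -> others)) : {measure set others -> \bar R}).
  exact: measurable_id_others.
have m2E C : m2 C = (Pr C * mu B)%E by rewrite /m2/= /mscale/= fineK// muleC.
rewrite -m2E -[LHS]/(m1 A).
apply: (@measure_unique _ R others cylinders_off (fun=> setT)) => //.
- exact: setI_closed_cylinders_off.
- by move=> _; exists [::], (fun=> setT); split=> //; apply/seteqP; split.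
- by rewrite bigcup_const.
- move=> _ [s [C [si mC ->]]]; rewrite m2E.
  rewrite /m1/= /pushforward/= /mrestr/= preimage_id cylinder_big.
  have mC' j : measurable (if j == i then B else C j) by case: ifP.
  have := iidX.2 (i :: undup s) (fun j => if j == i then B else C j).
  rewrite /= mem_undup si undup_uniq => /(_ isT mC').
  have Cj j : j \in undup s -> (if j == i then B else C j) = C j.
    by rewrite mem_undup; case: eqP => // -> /(negP si).
  rewrite !big_cons eqxx setIC muleC.
  rewrite (eq_big_seq (fun j => X j @^-1` C j)) => [|j js]; last by rewrite Cj.
  rewrite (eq_big_seq (fun j => mu (C j))) => [|j js]; last by rewrite Cj.
  by rewrite -(iidX.2 (undup s) C (undup_uniq s) mC).
- move=> _; rewrite /m1/= /pushforward/= /mrestr/= preimage_setT setTI.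
  exact: (le_lt_trans (probability_le1 _ mXB) (ltry 1)).
Qed.

(** The identity into [others] is the random variable that carries all samples but the i-th;
    functions measurable on [others] are functions of it. *)
Let Y : {mfun O >-> others} :=
  HB.pack (id : O -> others) (isMeasurableFun.Build _ _ _ _ _ measurable_id_others).
Let Xi : {mfun O >-> T} :=
  HB.pack (X i) (isMeasurableFun.Build _ _ _ _ _ (iidX.1 i)).

Lemma ge0_integral_others (f : others * T -> \bar R) :
  measurable_fun setT f -> (forall z, 0 <= f z)%E ->
  (\int[Pr]_w f ((w : others), X i w) = \int[Pr]_w \int[mu]_t f ((w : others), t))%E.
Proof. exact: (@ge0_integral_joint_law _ _ _ _ _ _ _ Pr mu Y Xi others_indep). Qed.

Lemma integral_others (f : others * T -> \bar R) :
  measurable_fun setT f ->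
  Pr.-integrable setT (fun w => f ((w : others), X i w)) ->
  (\int[Pr]_w f ((w : others), X i w) = \int[Pr]_w \int[mu]_t f ((w : others), t))%E.
Proof.
exact: (@integral_joint_law_integrable _ _ _ _ _ _ _ Pr mu Y Xi others_indep).
Qed.

End OtherSamples.

(** * Stochastic gradient at a point independent of the fresh sample *)

Section StochasticGradient.
Context {R : realType} {d : nat} {I : choiceType} {dO dT : measure_display}.
Context {O : measurableType dO} {T : measurableType dT}.
Variables (Pr : probability O R) (mu : probability T R) (X : I -> O -> T).
Variables (G : 'rV[R]_d -> T -> 'rV[R]_d) (gradF : 'rV[R]_d -> 'rV[R]_d) (L M : R).
Hypothesis iidX : iid_with_law Pr mu X.
Hypothesis hL : forall w w', norm2 (gradF w - gradF w') <= L * norm2 (w - w').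
Hypothesis hGmeas : forall i : 'I_d,
  measurable_fun setT (fun p : (Rd_borel R d * T)%type => G p.1 p.2 0 i).
Hypothesis hGint : forall w (i : 'I_d), mu.-integrable setT (fun t => (G w t 0 i)%:E).
Hypothesis hGmean : forall w, mean_vec mu (G w) = gradF w.
Hypothesis hGvar : forall w,
  (\int[mu]_t (sqnorm (G w t))%:E - (sqnorm (mean_vec mu (G w)))%:E <= M%:E)%E.

Lemma measurable_vec_G dS (S : measurableType dS) (W : S -> 'rV[R]_d) (Z : S -> T) :
  measurable_vec W -> measurable_fun setT Z -> measurable_vec (fun s => G (W s) (Z s)).
Proof.
move=> mW mZ i.
apply: (@measurableT_comp _ _ _ _ _ _ (fun p : (Rd_borel R d * T)%type => G p.1 p.2 0 i : R)
  _ (fun s => ((W s : Rd_borel R d), Z s)) (hGmeas i)).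
by apply: measurable_fun_pair => //; exact: measurable_to_Rd_borel.
Qed.

Lemma measurable_vec_gradF dS (S : measurableType dS) (W : S -> 'rV[R]_d) :
  measurable_vec W -> measurable_vec (gradF \o W).
Proof.
move=> mW i.
apply: (@measurableT_comp _ _ _ _ _ _ (fun w : Rd_borel R d => gradF w 0 i : R)
  _ (W : S -> Rd_borel R d)); last exact: measurable_to_Rd_borel.
by apply: measurable_continuous_Rd; exact: continuous_gradF_coord hL i.
Qed.

Lemma sqnorm_gradFB w w' : sqnorm (gradF w - gradF w') <= L ^+ 2 * sqnorm (w - w').
Proof.
rewrite -!norm2_sqr -exprMn lerXn2r ?nnegrE ?norm2_ge0//.
exact: le_trans (norm2_ge0 _) (hL w w').
Qed.

Lemma sq_integrable_gradF (W : O -> 'rV[R]_d) : sq_integrable Pr W ->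
  sq_integrable Pr (gradF \o W).
Proof.
move=> [mW iW].
pose c := 2 * sqnorm (gradF 0).
apply: (@sq_integrable_le _ _ _ _ _ _ (fun w => c + 2 * L ^+ 2 * sqnorm (W w))).
- exact: measurable_vec_gradF.
- rewrite (_ : EFin \o _ = ((EFin \o cst c) \+
      (fun w => (2 * L ^+ 2)%:E * (sqnorm (W w))%:E))%E)//.
  apply: integrableD => //; first exact: finite_measure_integrable_cst.
  exact: integrableZl.
- move=> w /=; have := sqnorm_gradFB (W w) 0; rewrite subr0 /c.
  (* |u - 2v|^2 >= 0 rearranges |u|^2 <= 2|v|^2 + 2|u - v|^2, here with u = grad F(W) and v = grad
     F(0). *)
  have := sqnorm_ge0 (gradF (W w) - 2 *: gradF 0).
  rewrite !sqnormB dotvZr sqnormZ; lra.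
Qed.

Section OneSample.
Variables (i : I) (W : O -> 'rV[R]_d).
Hypothesis mW : measurable_vec (W : others X i -> 'rV[R]_d).
Hypothesis iW : sq_integrable Pr W.

Let mGW : measurable_vec (fun z : others X i * T => G (W z.1) z.2).
Proof.
apply: measurable_vec_G; last exact: measurable_snd.
move=> j; exact: (@measurableT_comp _ _ _ _ _ _ (fun s : others X i => W s 0 j : R)
  _ (fst : others X i * T -> others X i) (mW j) measurable_fst).
Qed.

(** With the other samples fixed, W is a constant, and integrating the fresh sample against [mu]
    gives at most M + |grad F(W)|^2 by [hGvar] and [hGmean]. The extended-real form yields
    finiteness as well. *)
Let int_sqnorm_le :
  (\int[Pr]_w (sqnorm (G (W w) (X i w)))%:E <= (M + inner Pr (gradF \o W) (gradF \o W))%:E)%E.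
Proof.
have iF := sq_integrable_gradF iW.
rewrite (ge0_integral_others iidX (f := fun z : others X i * T => (sqnorm (G (W z.1) z.2))%:E));
  [|by apply/measurable_EFinP; exact: measurable_sqnorm | by move=> z; rewrite lee_fin sqnorm_ge0].
rewrite EFinD EFin_inner//.
have -> : (M%:E = \int[Pr]_w M%:E)%E.
  rewrite (integral_cst Pr measurableT M%:E).
  rewrite [X in (_ * X)%E](_ : _ = 1%E) ?mule1//; exact: probability_setT.
rewrite -integralD//; [|exact: finite_measure_integrable_cst | by case: iF].
apply: ge0_le_integral => //.
- by move=> w _; apply: integral_ge0 => t _; rewrite lee_fin sqnorm_ge0.
- apply: (@measurableT_comp _ _ _ _ _ _ (fun s : others X i =>
    \int[mu]_t (sqnorm (G (W (s, t).1) (s, t).2))%:E)%E _ (id : O -> others X i));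
    last exact: measurable_id_others iidX i.
  apply: (measurable_fun_fubini_tonelli_F
    (fun z : others X i * T => (sqnorm (G (W z.1) z.2))%:E)).
    by apply/measurable_EFinP; exact: measurable_sqnorm.
  by move=> z; rewrite lee_fin sqnorm_ge0.
- apply: (@measurable_EFinP _ _ _ _ (fun w => M + sqnorm (gradF (W w)))).2.
  apply: measurable_funD => //; apply: measurable_sqnorm.
  by case: iF.
- move=> w _ /=; have := hGvar (W w); rewrite hGmean.
  by rewrite leeBlDr.
Qed.

Lemma sq_integrable_G : sq_integrable Pr (fun w => G (W w) (X i w)).
Proof.
apply: sq_integrableP; last exact: le_lt_trans int_sqnorm_le (ltry _).
by apply: measurable_vec_G; [case: iW | exact: iidX.1].
Qed.

Lemma inner_G_le : inner Pr (fun w => G (W w) (X i w)) (fun w => G (W w) (X i w)) <=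
  M + inner Pr (gradF \o W) (gradF \o W).
Proof. by rewrite -lee_fin EFin_inner//; exact: sq_integrable_G. Qed.

(** V and W are determined by the other samples, so the fresh sample can be integrated first; the
    inner product is linear, and the mean of G at W is the gradient. *)
Lemma inner_G_unbiased (V : O -> 'rV[R]_d) :
  measurable_vec (V : others X i -> 'rV[R]_d) -> sq_integrable Pr V ->
  inner Pr V (fun w => G (W w) (X i w)) = inner Pr V (gradF \o W).
Proof.
move=> mV iV; congr fine.
rewrite (integral_others iidX (f := fun z : others X i * T => (dotv (V z.1) (G (W z.1) z.2))%:E)).
- apply: eq_integral => w _ /=.
  rewrite -hGmean /dotv.
  under eq_integral do rewrite -sumEFin.
  rewrite integral_sum//; last first.
    by move=> k; under eq_fun do rewrite EFinM; exact: integrableZl.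
  rewrite -sumEFin; apply: eq_bigr => k _.
  rewrite mxE EFinM fineK; last exact: integrable_fin_num.
  by under eq_integral do rewrite EFinM; rewrite integralZl.
- apply/measurable_EFinP; apply: measurable_dotv => //.
  move=> j; exact: (@measurableT_comp _ _ _ _ _ _ (fun s : others X i => V s 0 j : R)
    _ (fst : others X i * T -> others X i) (mV j) measurable_fst).
- by apply: integrable_dotv => //; exact: sq_integrable_G.
Qed.

End OneSample.
End StochasticGradient.

(** * The K-AVG iteration *)

Section Algorithm.
Context {R : realType} {d : nat} {dT : measure_display} {T : measurableType dT}.
Variable G : 'rV[R]_d -> T -> 'rV[R]_d.
Hypothesis hGmeas : forall i : 'I_d,
  measurable_fun setT (fun p : (Rd_borel R d * T)%type => G p.1 p.2 0 i).

(** The domain S is arbitrary so that it can be taken as [others]; only samples of round n and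
    processor j with step label at most k enter. *)
Lemma measurable_local_iter dS (S : measurableType dS)
    (Z : nat * nat * nat * nat -> S -> T) (g : R) (B n j k : nat) (W : S -> 'rV[R]_d) :
  measurable_vec W ->
  (forall k' s, (k' <= k)%N -> measurable_fun setT (Z (n, j, k', s))) ->
  measurable_vec (fun s => local_iter G (fun a => Z a s) g B n j (W s) k).
Proof.
move=> mW; elim: k => [//|k IH] mZ.
have mk : measurable_vec (fun s => local_iter G (fun a => Z a s) g B n j (W s) k).
  by apply: IH => k' s k'k; apply: mZ; exact: leqW.
apply: measurable_vecD => //.
under eq_fun do rewrite -scaleNr.
apply: measurable_vecZ; apply: measurable_vec_sum => s.
by apply: measurable_vec_G => //; exact: mZ.
Qed.

Lemma measurable_kavg_aux dS (S : measurableType dS)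
    (Z : nat * nat * nat * nat -> S -> T) gamma Bs P K w1 m :
  (forall n j k s, (n <= m)%N -> measurable_fun setT (Z (n, j, k, s))) ->
  measurable_vec (fun s => kavg_aux G (fun a => Z a s) gamma Bs P K w1 m).
Proof.
elim: m => [|m IH] mZ; first exact: measurable_vec_cst.
apply: measurable_vecZ; apply: measurable_vec_sum => j.
apply: measurable_local_iter => [|k s _]; last exact: mZ.
by apply: IH => n j' k s nm; apply: mZ; exact: leqW.
Qed.

End Algorithm.

(** * Two finite sums over the local steps *)

Lemma sum_nat_sqr {R : realFieldType} (n : nat) :
  \sum_(0 <= k < n) (k%:R ^+ 2 : R) = n%:R * (n%:R - 1) * (2 * n%:R - 1) / 6.
Proof.
elim: n => [|n IH]; first by rewrite big_geq// !mul0r.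
by rewrite big_nat_recr//= IH -natr1; field.
Qed.

(** After exchanging the sums, [a i] has weight n(n-1)/2 - i(i+1)/2. For i >= 1 this is at most
    n(n-1)/2 - 1 = (n+1)(n-2)/2, and for i = 0 it is one more, whence the extra [a 0]. The proof is
    an induction from n = 1. *)
Lemma sum_weighted_prefix_le {R : realFieldType} (a : nat -> R) (n : nat) :
  (1 <= n)%N -> (forall i, 0 <= a i) ->
  \sum_(0 <= k < n) k%:R * \sum_(0 <= i < k) a i <=
  (n%:R + 1) * (n%:R - 2) / 2 * \sum_(0 <= i < n) a i + a 0%N.
Proof.
move=> + a0; case: n => // n _; elim: n => [|n IH].
  by rewrite !big_nat1 mul0r; lra.
rewrite big_nat_recr//= [in leRHS]big_nat_recr//=.
set S := \sum_(0 <= i < n.+1) a i in IH *.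
rewrite -(natr1 n.+1).
have n1 : (1 : R) <= n.+1%:R by rewrite ler1n.
have := a0 n.+1; move: IH n1.
set x := n.+1%:R; set b := a n.+1; set c := a 0%N; set t := \sum_(_ <= _ < _) _.
by nra.
Qed.

(** * Iterates with constant stepsize and batch size *)

Section KAvg.
Context {R : realType} {d : nat} {dO dT : measure_display}.
Context {O : measurableType dO} {T : measurableType dT}.
Variables (Pr : probability O R) (mu : probability T R).
Variables (G : 'rV[R]_d -> T -> 'rV[R]_d) (gradF : 'rV[R]_d -> 'rV[R]_d) (L M : R).
Variables (P K B : nat) (g : R) (w1 : 'rV[R]_d) (xi : nat * nat * nat * nat -> O -> T).
Hypothesis iidX : iid_with_law Pr mu xi.
Hypothesis hL : forall w w', norm2 (gradF w - gradF w') <= L * norm2 (w - w').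
Hypothesis hGmeas : forall i : 'I_d,
  measurable_fun setT (fun p : (Rd_borel R d * T)%type => G p.1 p.2 0 i).
Hypothesis hGint : forall w (i : 'I_d), mu.-integrable setT (fun t => (G w t 0 i)%:E).
Hypothesis hGmean : forall w, mean_vec mu (G w) = gradF w.
Hypothesis hGvar : forall w,
  (\int[mu]_t (sqnorm (G w t))%:E - (sqnorm (mean_vec mu (G w)))%:E <= M%:E)%E.
Hypotheses (hP : (1 <= P)%N) (hK : (1 <= K)%N) (hB : (1 <= B)%N) (hg : 0 < g).

Definition round_iter n (om : O) : 'rV[R]_d :=
  kavg_w G (fun a => xi a om) (fun=> g) (fun=> B) P K w1 n.
Definition step_iter n j k (om : O) : 'rV[R]_d :=
  local_iter G (fun a => xi a om) g B n j (round_iter n om) k.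
(** The step from local iterate k to k + 1 draws the samples labelled k + 1, because labels start at
    1. *)
Definition sample_grad n j k s (om : O) : 'rV[R]_d :=
  G (step_iter n j k om) (xi (n, j, k.+1, s) om).
Definition batch_grad n j k (om : O) : 'rV[R]_d :=
  B%:R^-1 *: \sum_(1 <= s < B.+1) sample_grad n j k s om.
Definition increment n (om : O) : 'rV[R]_d := round_iter n.+1 om - round_iter n om.
Definition grad_at (X : O -> 'rV[R]_d) (om : O) : 'rV[R]_d := gradF (X om).

Lemma step_iterS n j k om :
  step_iter n j k.+1 om = step_iter n j k om - g *: batch_grad n j k om.
Proof. by rewrite /step_iter /= /batch_grad scalerA. Qed.

Lemma step_iterE n j k om :
  step_iter n j k om = round_iter n om - g *: \sum_(0 <= i < k) batch_grad n j i om.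
Proof.
elim: k => [|k IH]; first by rewrite big_geq// scaler0 subr0.
by rewrite step_iterS IH big_nat_recr//= scalerDr opprD addrA.
Qed.

(** All processors start at the same point, which the average reproduces, leaving only the
    gradients. The case n = 0 is excluded because [kavg_w] is indexed through [n.-1], so
    [round_iter 0] and [round_iter 1] coincide. *)
Lemma incrementE n : (0 < n)%N -> increment n = fun om =>
  - (g / P%:R) *: \sum_(1 <= j < P.+1) \sum_(0 <= k < K) batch_grad n j k om.
Proof.
case: n => // n _; apply/funext => om; rewrite /increment.
have -> : round_iter n.+2 om =
    P%:R^-1 *: \sum_(1 <= j < P.+1) step_iter n.+1 j K om by [].
under eq_bigr do rewrite step_iterE.
have P0 : P%:R != 0 :> R by rewrite pnatr_eq0 -lt0n.
rewrite sumrB sumr_const_nat subSS subn0 -scaler_sumr scalerBr scalerA.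
rewrite -(scaler_nat P (round_iter n.+1 om)).
by rewrite scalerA mulVf// scale1r addrAC subrr add0r scaleNr mulrC.
Qed.

(** Round n starts from a point built only from samples of earlier rounds. *)
Lemma others_round_iter n i : (n <= i.1.1.1)%N -> (0 < n)%N ->
  measurable_vec (round_iter n : others xi i -> 'rV[R]_d).
Proof.
move=> ni n0; apply: (measurable_kavg_aux hGmeas (S := others xi i)) => n' j k s n'n.
apply: measurable_others_sample; apply/eqP => E; move: ni n'n; rewrite -E/=.
by case: n n0 => // n _ /=; rewrite ltnNge => /negP.
Qed.

(** Within round n, local iterate k of processor j has drawn only samples of processor j with label
    at most k, so any sample of another processor or of a later step is still fresh. *)
Lemma others_step_iter n j k j0 k0 s0 : (0 < n)%N -> (j0 != j) || (k < k0)%N ->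
  measurable_vec (step_iter n j k : others xi (n, j0, k0, s0) -> 'rV[R]_d).
Proof.
move=> n0 jk; apply: (measurable_local_iter hGmeas (S := others xi _)).
  exact: others_round_iter.
move=> k' s k'k; apply: measurable_others_sample; apply/eqP => -[jj0 kk0 _].
by move: jk; rewrite jj0 eqxx/= -kk0 ltnNge k'k.
Qed.

Lemma others_sample_grad n j k s j0 k0 s0 : (0 < n)%N -> (j0 != j) || (k < k0)%N ->
  (n, j, k.+1, s) != (n, j0, k0, s0) ->
  measurable_vec (sample_grad n j k s : others xi (n, j0, k0, s0) -> 'rV[R]_d).
Proof.
move=> n0 jk ns; apply: (measurable_vec_G hGmeas (S := others xi _)).
  exact: others_step_iter.
exact: measurable_others_sample.
Qed.

Lemma others_batch_grad n j k j0 k0 s0 : (0 < n)%N -> j0 != j ->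
  measurable_vec (batch_grad n j k : others xi (n, j0, k0, s0) -> 'rV[R]_d).
Proof.
move=> n0 jj; apply: measurable_vecZ; apply: measurable_vec_sum => s.
apply: others_sample_grad => //; first by rewrite jj.
by apply: contra jj => /eqP[->].
Qed.

Lemma sq_integrable_sample_grad n j k s : (0 < n)%N -> sq_integrable Pr (step_iter n j k) ->
  sq_integrable Pr (sample_grad n j k s).
Proof.
move=> n0 iu; apply: (sq_integrable_G iidX hL hGmeas hGmean hGvar) => //.
by apply: others_step_iter => //; rewrite ltnSn orbT.
Qed.

Lemma sq_integrable_batch n j k : (0 < n)%N -> sq_integrable Pr (step_iter n j k) ->
  sq_integrable Pr (batch_grad n j k).
Proof.
move=> n0 iu; apply: sq_integrableZ; apply: sq_integrable_sum => s _.
exact: sq_integrable_sample_grad.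
Qed.

Lemma sq_integrable_step n j k : (0 < n)%N -> sq_integrable Pr (round_iter n) ->
  sq_integrable Pr (step_iter n j k).
Proof.
move=> n0 iw; elim: k => [//|k IH].
rewrite (_ : step_iter n j k.+1 = fun om => step_iter n j k om - g *: batch_grad n j k om);
  last by apply/funext => om; exact: step_iterS.
by apply: sq_integrableB => //; apply: sq_integrableZ; exact: sq_integrable_batch.
Qed.

Lemma sq_integrable_round n : (0 < n)%N -> sq_integrable Pr (round_iter n).
Proof.
case: n => // n _; elim: n => [|n IH]; first exact: sq_integrable_cst.
apply: (@sq_integrableZ _ _ _ _ _ _
  (fun om => \sum_(1 <= j < P.+1) step_iter n.+1 j K om)).
by apply: sq_integrable_sum => j _; exact: sq_integrable_step.
Qed.


Section Round.
Variable n : nat.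
Hypothesis n0 : (0 < n)%N.

Let gradw := grad_at (round_iter n).
Let gradu j k := grad_at (step_iter n j k).
(** [step_iter n j 0] is [round_iter n] by computation, so [a j 0] is E|grad F(w)|^2 for every j. *)
Let a j k := inner Pr (gradu j k) (gradu j k).
(** The coefficient in [sum_weighted_prefix_le] for n = K, which is also the one in the first
    stepsize condition. *)
Let c : R := (K%:R + 1) * (K%:R - 2) / 2.

Let iu j k : sq_integrable Pr (step_iter n j k).
Proof. by apply: sq_integrable_step => //; exact: sq_integrable_round. Qed.

Let ib j k : sq_integrable Pr (batch_grad n j k).
Proof. exact: sq_integrable_batch. Qed.

Let isg j k s : sq_integrable Pr (sample_grad n j k s).
Proof. exact: sq_integrable_sample_grad. Qed.

Let igu j k : sq_integrable Pr (gradu j k).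
Proof. exact: (sq_integrable_gradF hL (iu j k)). Qed.

Let igw : sq_integrable Pr gradw.
Proof. exact: (igu 0 0). Qed.

Let B0 : B%:R != 0 :> R.
Proof. by rewrite pnatr_eq0 -lt0n. Qed.

Lemma inner_sample_grad (V : O -> 'rV[R]_d) j k s :
  measurable_vec (V : others xi (n, j, k.+1, s) -> 'rV[R]_d) -> sq_integrable Pr V ->
  inner Pr V (sample_grad n j k s) = inner Pr V (gradu j k).
Proof.
move=> mV iV; apply: (inner_G_unbiased iidX hL hGmeas hGint hGmean hGvar) => //.
by apply: others_step_iter => //; rewrite ltnSn orbT.
Qed.

Lemma inner_batch_grad (V : O -> 'rV[R]_d) j k :
  (forall s, measurable_vec (V : others xi (n, j, k.+1, s) -> 'rV[R]_d)) ->
  sq_integrable Pr V -> inner Pr V (batch_grad n j k) = inner Pr V (gradu j k).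
Proof.
move=> mV iV; rewrite innerZr//; last by apply: sq_integrable_sum => s _; exact: isg.
rewrite inner_sumr//; under eq_bigr do rewrite inner_sample_grad//.
by rewrite sumr_const_nat subSS subn0 -(mulr_natl (inner _ _ _)) mulrA mulVf// mul1r.
Qed.

(** The samples of a batch are taken at the same point: cross terms are [a j k] by unbiasedness,
    diagonal ones at most [M + a j k], so only the variance is divided by B. *)
Lemma inner_batch_grad_le j k :
  inner Pr (batch_grad n j k) (batch_grad n j k) <= M / B%:R + a j k.
Proof.
have iS : sq_integrable Pr (fun om => \sum_(1 <= s < B.+1) sample_grad n j k s om).
  by apply: sq_integrable_sum => s _; exact: isg.
have mstep s : measurable_vec (step_iter n j k : others xi (n, j, k.+1, s) -> 'rV[R]_d).
  by apply: others_step_iter => //; rewrite ltnSn orbT.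
rewrite innerZl// innerZr// mulrA.
have /= := @inner_sum_le _ _ _ _ Pr _ (index_iota 1 B.+1) (sample_grad n j k)
  (fun=> a j k) (fun=> M + a j k) (iota_uniq _ _) (fun s _ => isg j k s).
rewrite size_iota subSS subn0 => h.
have {}h : inner Pr (fun om => \sum_(1 <= s < B.+1) sample_grad n j k s om)
   (fun om => \sum_(1 <= s < B.+1) sample_grad n j k s om) <=
   B%:R * M + B%:R * (B%:R * a j k).
  apply: (le_trans (h _ _)) => [s _|s t _ _ st|].
  - exact: (inner_G_le iidX hL hGmeas hGmean hGvar).
  (* Sample t is averaged first, with sample s still in place; then s is averaged against the
     gradient that remains. *)
  - rewrite inner_sample_grad//; last first.
      apply: others_sample_grad => //; first by rewrite ltnSn orbT.
      by apply: contra st => /eqP[->].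
    rewrite innerC inner_sample_grad//; first by rewrite /a; lra.
    exact: (measurable_vec_gradF hL (S := others xi _)).
  - by rewrite !sumr_const_nat subSS subn0 addrK -(mulr_natl M) -(mulr_natl (a j k)).
apply: (@le_trans _ _ (B%:R^-1 * B%:R^-1 * (B%:R * M + B%:R * (B%:R * a j k)))).
  by rewrite ler_wpM2l// mulr_ge0 ?invr_ge0.
by rewrite le_eqVlt; apply/orP; left; apply/eqP; field.
Qed.

(* Different processors draw different samples, so each of the two batches may be
   averaged while the other one is kept fixed. *)
Lemma inner_batch_grad_cross j l k m : j != l ->
  inner Pr (batch_grad n j k) (batch_grad n l m) = inner Pr (gradu j k) (gradu l m).
Proof.
move=> jl; rewrite inner_batch_grad//; last first.
  by move=> s; apply: others_batch_grad => //; rewrite eq_sym.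
rewrite innerC inner_batch_grad//; first exact: innerC.
move=> s; apply: (measurable_vec_gradF hL (S := others xi _)).
by apply: others_step_iter => //; rewrite jl.
Qed.

Let drift j k om := step_iter n j k om - round_iter n om.

Let idrift j k : sq_integrable Pr (drift j k).
Proof. by apply: sq_integrableB => //; exact: (iu 0 0). Qed.

Lemma inner_drift_le j k : inner Pr (drift j k) (drift j k) <=
  g ^+ 2 * (k%:R * \sum_(0 <= i < k) (M / B%:R + a j i)).
Proof.
have -> : drift j k = fun om => (- g) *: \sum_(0 <= i < k) batch_grad n j i om.
  by apply/funext => om; rewrite /drift step_iterE addrAC subrr add0r scaleNr.
have iS : sq_integrable Pr (fun om => \sum_(0 <= i < k) batch_grad n j i om).
  by apply: sq_integrable_sum => s _; exact: ib.
rewrite innerZ_sqr// sqrrN ler_wpM2l ?sqr_ge0//.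
have := @inner_sum_le_size _ _ _ _ Pr _ (index_iota 0 k) (batch_grad n j)
  (iota_uniq _ _) (fun i _ => ib j i).
rewrite size_iota subn0 => /le_trans; apply; rewrite ler_wpM2l//.
by apply: ler_sum => i _; exact: inner_batch_grad_le.
Qed.

Lemma inner_grad_batch_ge j k : a j 0 + a j k - L ^+ 2 * inner Pr (drift j k) (drift j k) <=
  2 * inner Pr gradw (batch_grad n j k).
Proof.
rewrite inner_batch_grad//; last first.
  move=> s; apply: (measurable_vec_gradF hL (S := others xi _)).
  exact: others_round_iter.
(* The Lipschitz bound on the gradient difference, whose expansion by [innerB_sqr] isolates twice
   the inner product. *)
have h : inner Pr (fun om => gradw om - gradu j k om)
    (fun om => gradw om - gradu j k om) <= inner Pr (fun om => L *: drift j k om)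
    (fun om => L *: drift j k om).
  apply: inner_le; try exact: sq_integrableB; try exact: sq_integrableZ.
  move=> om; rewrite !dotvv sqnormZ /drift.
  have -> : sqnorm (step_iter n j k om - round_iter n om) =
      sqnorm (round_iter n om - step_iter n j k om) by rewrite !sqnormB dotvC; ring.
  exact: (sqnorm_gradFB hL).
move: h; rewrite innerB_sqr// innerZ_sqr// -/(a j k) -[inner Pr gradw gradw]/(a j 0).
lra.
Qed.

Let A j := \sum_(0 <= k < K) a j k.
(** Closed form of the sum of k^2 over k < K, which collects the noise part of the drift. *)
Let s2 : R := K%:R * (K%:R - 1) * (2 * K%:R - 1) / 6.

Lemma inner_grad_batch_sum_ge j :
  K%:R * a j 0 + A j - L ^+ 2 * g ^+ 2 * (M / B%:R * s2 + c * A j + a j 0) <=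
  2 * \sum_(0 <= k < K) inner Pr gradw (batch_grad n j k).
Proof.
have hD : \sum_(0 <= k < K) inner Pr (drift j k) (drift j k) <=
    g ^+ 2 * (M / B%:R * s2 + c * A j + a j 0).
  apply: (@le_trans _ _ (\sum_(0 <= k < K)
      (g ^+ 2 * (M / B%:R * k%:R ^+ 2 + k%:R * \sum_(0 <= i < k) a j i)))).
    apply: ler_sum => k _; apply: (le_trans (inner_drift_le _ _)).
    rewrite big_split/= sumr_const_nat subn0 -(mulr_natl (M / _)).
    by rewrite le_eqVlt; apply/orP; left; apply/eqP; ring.
  rewrite -mulr_sumr ler_wpM2l ?sqr_ge0// big_split/= -mulr_sumr sum_nat_sqr.
  rewrite -addrA lerD2l.
  by apply: sum_weighted_prefix_le => // i; exact: inner_ge0.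
rewrite [leRHS]mulr_sumr.
apply: (@le_trans _ _ (\sum_(0 <= k < K)
   (a j 0 + a j k - L ^+ 2 * inner Pr (drift j k) (drift j k)))).
  rewrite sumrB big_split/= sumr_const_nat subn0 -(mulr_natl (a j 0)) -mulr_sumr.
  by rewrite lerB// -(mulrA (L ^+ 2)); exact: (ler_wpM2l (sqr_ge0 L) hD).
by apply: ler_sum => k _; exact: inner_grad_batch_ge.
Qed.

Let isum j : sq_integrable Pr (fun om => \sum_(0 <= k < K) batch_grad n j k om).
Proof. by apply: sq_integrable_sum => k _; exact: ib. Qed.

Lemma sq_integrable_increment : sq_integrable Pr (increment n).
Proof.
apply: (@sq_integrableB _ _ _ _ Pr (round_iter n.+1) (round_iter n));
  exact: sq_integrable_round.
Qed.

Lemma inner_grad_increment : inner Pr gradw (increment n) =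
  - (g / P%:R) * \sum_(1 <= j < P.+1) \sum_(0 <= k < K) inner Pr gradw (batch_grad n j k).
Proof.
rewrite incrementE//.
rewrite innerZr//; last by apply: sq_integrable_sum => j _; exact: isum.
rewrite inner_sumr//; congr (_ * _); apply: eq_bigr => j _.
by rewrite inner_sumr.
Qed.

Lemma inner_increment_le : inner Pr (increment n) (increment n) <=
  (g / P%:R) ^+ 2 * (P%:R * (K%:R ^+ 2 * (M / B%:R)) +
    P%:R * (K%:R * \sum_(1 <= j < P.+1) A j)).
Proof.
rewrite incrementE//.
have iS : sq_integrable Pr (fun om =>
    \sum_(1 <= j < P.+1) \sum_(0 <= k < K) batch_grad n j k om).
  by apply: sq_integrable_sum => j _; exact: isum.
rewrite innerZ_sqr// sqrrN ler_wpM2l ?sqr_ge0//.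
(* Cross terms between processors carry no variance, and the diagonal excess is K^2 M/B. It occurs P
   times rather than P^2 times, which gives the factor 1/P. *)
apply: (le_trans (@inner_sum_le _ _ _ _ Pr _ (index_iota 1 P.+1)
  (fun j om => \sum_(0 <= k < K) batch_grad n j k om)
  (fun j => K%:R * A j) (fun j => K%:R * (K%:R * (M / B%:R) + A j)) (iota_uniq _ _)
  (fun j _ => isum j) _ _)) => [j _|j l _ _ jl|].
- have := @inner_sum_le_size _ _ _ _ Pr _ (index_iota 0 K) (batch_grad n j)
    (iota_uniq _ _) (fun k _ => ib j k).
  rewrite size_iota subn0 => /le_trans; apply; rewrite ler_wpM2l//.
  rewrite mulr_natl -[X in _ *+ X]subn0 -sumr_const_nat -big_split/=.
  by apply: ler_sum => k _; exact: inner_batch_grad_le.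
- have -> : inner Pr (fun om => \sum_(0 <= k < K) batch_grad n j k om)
      (fun om => \sum_(0 <= k < K) batch_grad n l k om) =
    inner Pr (fun om => \sum_(0 <= k < K) gradu j k om)
      (fun om => \sum_(0 <= k < K) gradu l k om).
    rewrite !inner_suml//; last by apply: sq_integrable_sum => k _; exact: igu.
    apply: eq_bigr => k _; rewrite !inner_sumr//; apply: eq_bigr => m _.
    exact: inner_batch_grad_cross.
  have ig j' : sq_integrable Pr (fun om => \sum_(0 <= k < K) gradu j' k om).
    by apply: sq_integrable_sum => k _; exact: igu.
  have hs j' : inner Pr (fun om => \sum_(0 <= k < K) gradu j' k om)
      (fun om => \sum_(0 <= k < K) gradu j' k om) <= K%:R * A j'.
    have := @inner_sum_le_size _ _ _ _ Pr _ (index_iota 0 K) (gradu j')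
      (iota_uniq _ _) (fun k _ => igu j' k).
    by rewrite size_iota subn0.
  have := inner_AMGM (ig j) (ig l); have := hs j; have := hs l; lra.
rewrite size_iota subSS subn0.
under eq_bigr do rewrite mulrDr addrK.
rewrite sumr_const_nat subSS subn0 -[_ *+ P]mulr_natl -mulr_sumr.
by rewrite (mulrA K%:R) -expr2.
Qed.

Lemma round_descent_le (delta : R) : 0 < L ->
  L ^+ 2 * g ^+ 2 * (K%:R + 1) * (K%:R - 2) / 2 + L * g * K%:R <= 1 ->
  L ^+ 2 * g ^+ 2 <= 1 - delta ->
  inner Pr gradw (increment n) + L / 2 * inner Pr (increment n) (increment n) <=
  - (g / 2 * (K%:R - 1 + delta)) * inner Pr gradw gradw +
  (g / 2 * (L ^+ 2 * g ^+ 2 * (M / B%:R * s2)) + L / 2 * g ^+ 2 * (K%:R ^+ 2 * M / (B%:R * P%:R))).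
Proof.
move=> L0 hc1 hc2.
have P0 : 0 < P%:R :> R by rewrite ltr0n.
pose a0 := a 0 0; pose SA := \sum_(1 <= j < P.+1) A j.
have SA0 : 0 <= SA by do 2 (apply: sumr_ge0 => ? _); exact: inner_ge0.
have a00 : 0 <= a0 by exact: inner_ge0.
pose I1 := \sum_(1 <= j < P.+1) \sum_(0 <= k < K) inner Pr gradw (batch_grad n j k).
have h1 : P%:R * (K%:R * a0 - L ^+ 2 * g ^+ 2 * (M / B%:R * s2 + a0)) +
    (1 - L ^+ 2 * g ^+ 2 * c) * SA <= 2 * I1.
  have e (x : R) : P%:R * x = \sum_(1 <= j < P.+1) x.
    by rewrite sumr_const_nat subSS subn0 (mulr_natl x P).
  rewrite e /I1 /SA !mulr_sumr -big_split/=.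
  apply: ler_sum => j _; apply: le_trans (inner_grad_batch_sum_ge j).
  by rewrite le_eqVlt; apply/orP; left; apply/eqP; rewrite -[a j 0]/a0; ring.
rewrite inner_grad_increment -/I1.
have h2 := inner_increment_le; rewrite -/SA in h2.
have -> : inner Pr gradw gradw = a0 by [].
set J := inner Pr (increment n) (increment n) in h2 *.
have {}h2 : L / 2 * J <= L / 2 * ((g / P%:R) ^+ 2 * (P%:R * (K%:R ^+ 2 * (M / B%:R)) +
    P%:R * (K%:R * SA))).
  by rewrite ler_wpM2l// divr_ge0// ltW.
have {}h1 : - (g / P%:R) * I1 <= - (g / P%:R) / 2 *
    (P%:R * (K%:R * a0 - L ^+ 2 * g ^+ 2 * (M / B%:R * s2 + a0)) +
    (1 - L ^+ 2 * g ^+ 2 * c) * SA).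
  rewrite !mulNr lerN2 -mulrA ler_wpM2l//; last lra.
  by rewrite divr_ge0// ltW.
(* The first stepsize condition makes the coefficient of all local gradients
   nonnegative; the second one bounds the loss in the coefficient of a0. *)
have h3 : 0 <= g / P%:R / 2 * SA * (1 - L ^+ 2 * g ^+ 2 * c - L * g * K%:R).
  rewrite mulr_ge0 ?mulr_ge0 ?invr_ge0 ?(ltW hg) ?(ltW P0)//.
  rewrite /c; lra.
have h4 : 0 <= g / 2 * a0 * (1 - delta - L ^+ 2 * g ^+ 2).
  by rewrite mulr_ge0 ?mulr_ge0 ?invr_ge0 ?(ltW hg)// subr_ge0.
apply: (le_trans (lerD h1 h2)).
(* The gap between the two sides is exactly the sum of the quantities in [h3] and [h4]. *)
rewrite -subr_ge0; apply: le_trans (addr_ge0 h3 h4) _.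
rewrite le_eqVlt; apply/orP; left; apply/eqP; field.
by rewrite B0/= gt_eqF.
Qed.

End Round.

End KAvg.

(** * Telescoping over the rounds *)

Theorem theorem1
  (R : realType) (d : nat)
  (F : 'rV[R]_d -> R) (gradF : 'rV[R]_d -> 'rV[R]_d) (L : R)
  (dT : measure_display) (T : measurableType dT) (mu : probability T R)
  (G : 'rV[R]_d -> T -> 'rV[R]_d) (M : R)
  (P K : nat) (gbar : R) (Bbar : nat) (w1 : 'rV[R]_d) (Fstar : R)
  (dO : measure_display) (Omega : measurableType dO) (Pr : probability Omega R)
  (xi : nat * nat * nat * nat -> Omega -> T) (delta : R)
  (* F continuously differentiable with gradient gradF, L-Lipschitz gradient *)
  (hF : forall w, differentiable F w /\ forall h, 'd F w h = dotv (gradF w) h)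
  (hL0 : 0 < L)
  (hL : forall w w', norm2 (gradF w - gradF w') <= L * norm2 (w - w'))
  (* stochastic gradient: jointly measurable, unbiased, bounded variance *)
  (hGmeas : forall i : 'I_d,
      measurable_fun setT (fun p : (Rd_borel R d * T)%type => G p.1 p.2 0 i))
  (hGint : forall w (i : 'I_d), mu.-integrable setT (fun t => (G w t 0 i)%:E))
  (hGmean : forall w, mean_vec mu (G w) = gradF w)
  (hM0 : 0 <= M)
  (hGvar : forall w,
      (\int[mu]_t (sqnorm (G w t))%:E - (sqnorm (mean_vec mu (G w)))%:E
        <= M%:E)%E)
  (* parameters *)
  (hP : (1 <= P)%N) (hK : (1 <= K)%N) (hB : (1 <= Bbar)%N) (hg : 0 < gbar)
  (* samples i.i.d. copies of xi *)
  (hxi : iid_with_law Pr mu xi)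
  (* F >= F* on an open set containing all iterates *)
  (hFstar : exists U : set 'rV[R]_d, open U /\
      (forall x, U x -> Fstar <= F x) /\
      (forall (om : Omega) (n j k : nat), (1 <= n)%N -> (1 <= j <= P)%N -> (k <= K)%N ->
         U (local_iter G (fun idx => xi idx om) gbar Bbar n j
              (kavg_w G (fun idx => xi idx om) (fun _ => gbar) (fun _ => Bbar) P K w1 n) k)))
  (* stepsize conditions *)
  (hdelta : 0 < delta < 1)
  (hc1 : L ^+ 2 * gbar ^+ 2 * (K%:R + 1) * (K%:R - 2) / 2 + L * gbar * K%:R <= 1)
  (hc2 : L ^+ 2 * gbar ^+ 2 <= 1 - delta) :
  forall N : nat, (1 <= N)%N ->
    ((N%:R)^-1%:E *
      \int[Pr]_om (\sum_(1 <= j < N.+1)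
          sqnorm (gradF (kavg_w G (fun idx => xi idx om) (fun _ => gbar)
                           (fun _ => Bbar) P K w1 j)))%:E
    <= (2 * (F w1 - Fstar) / (N%:R * (K%:R - 1 + delta) * gbar)
        + L * K%:R * gbar * M / (Bbar%:R * (K%:R - 1 + delta))
          * (K%:R / P%:R + L * (2 * K%:R - 1) * (K%:R - 1) * gbar / 6))%:E)%E.
Proof.
move=> N N1.
have [U [_ [hU hin]]] := hFstar.
pose W := round_iter G P K Bbar gbar w1 xi.
pose D := increment G P K Bbar gbar w1 xi.
have iW n : (0 < n)%N -> sq_integrable Pr (W n).
  exact: sq_integrable_round hxi hL hGmeas hGmean hGvar _.
have iD n : (0 < n)%N -> sq_integrable Pr (D n).
  exact: sq_integrable_increment hxi hL hGmeas hGmean hGvar _.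
have igW n : (0 < n)%N -> sq_integrable Pr (grad_at gradF (W n)).
  by move=> n0; exact: (sq_integrable_gradF hL (iW n n0)).
(* With this [V], the descent bound of round n is the single inner product <V, D>. *)
pose V n om := grad_at gradF (W n) om + (L / 2) *: D n om.
have iV n : (0 < n)%N -> sq_integrable Pr (V n).
  by move=> n0; apply: sq_integrableD; [exact: igW | apply: sq_integrableZ; exact: iD].
(* Telescoping happens on each sample path, before expectations, so that only inner products of
   square integrable vectors get integrated. *)
have path om : Fstar - F w1 <= \sum_(1 <= n < N.+1) dotv (V n om) (D n om).
  apply: (@le_trans _ _ (F (W N.+1 om) - F (W 1%N om))).
    rewrite lerD2r; apply: hU.
    (* The last iterate is local iterate 0 of processor 1 in round N + 1, which [hFstar] covers
       since P >= 1. *)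
    by have := hin om N.+1 1%N 0%N isT; rewrite hP => /(_ isT isT).
  elim: (N) => [|m IH]; first by rewrite big_geq// subrr.
  rewrite big_nat_recr//=.
  have := descent_lemma hF hL (W m.+1 om) (W m.+2 om).
  have -> : dotv (V m.+1 om) (D m.+1 om) = dotv (gradF (W m.+1 om)) (W m.+2 om - W m.+1 om)
      + L / 2 * sqnorm (W m.+2 om - W m.+1 om).
    by rewrite /V dotvDl dotvZl dotvv.
  move: IH; lra.
have memN n : n \in index_iota 1 N.+1 -> (0 < n)%N by rewrite mem_index_iota => /andP[].
have esum : Fstar - F w1 <= \sum_(1 <= n < N.+1) inner Pr (V n) (D n).
  rewrite -Rintegral_sum_dotv; [|by move=> n /memN; exact: iV|by move=> n /memN; exact: iD].
  have -> : Fstar - F w1 = \int[Pr]_om (Fstar - F w1).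
    by rewrite Rintegral_cst// [X in fine X](_ : _ = 1%E) ?mulr1//; exact: probability_setT.
  apply: le_Rintegral => //; first exact: finite_measure_integrable_cst.
  by apply: integrable_sum_dotv => n /memN; [exact: iV | exact: iD].
pose a n := inner Pr (grad_at gradF (W n)) (grad_at gradF (W n)).
have LHS : (\int[Pr]_om (\sum_(1 <= j < N.+1) sqnorm (gradF (kavg_w G (fun idx => xi idx om)
    (fun _ => gbar) (fun _ => Bbar) P K w1 j)))%:E = (\sum_(1 <= n < N.+1) a n)%:E)%E.
  have iS := @integrable_sum_dotv _ _ _ _ Pr _ (index_iota 1 N.+1)
    (fun n => grad_at gradF (W n)) (fun n => grad_at gradF (W n))
    (fun n h => igW n (memN n h)) (fun n h => igW n (memN n h)).
  rewrite -Rintegral_sum_dotv; try by move=> n /memN; exact: igW.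
  rewrite /Rintegral fineK; last exact: integrable_fin_num iS.
  by apply: eq_integral => om _; congr EFin; apply: eq_bigr => n _; rewrite dotvv.
rewrite LHS -EFinM lee_fin.
have /andP[d0 d1] := hdelta.
have K1 : (1 : R) <= K%:R by rewrite ler1n.
have q0 : 0 < K%:R - 1 + delta by lra.
have N0 : 0 < N%:R :> R by rewrite ltr0n.
have B0 : 0 < Bbar%:R :> R by rewrite ltr0n.
have P0 : 0 < P%:R :> R by rewrite ltr0n.
set q := K%:R - 1 + delta in q0 *.
pose C := gbar / 2 * (L ^+ 2 * gbar ^+ 2 *
    (M / Bbar%:R * (K%:R * (K%:R - 1) * (2 * K%:R - 1) / 6))) +
  L / 2 * gbar ^+ 2 * (K%:R ^+ 2 * M / (Bbar%:R * P%:R)).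
have round n : (0 < n)%N -> inner Pr (V n) (D n) <= - (gbar / 2 * q) * a n + C.
  move=> n0; rewrite innerDl//; [|exact: igW|by apply: sq_integrableZ; exact: iD|exact: iD].
  rewrite innerZl; [|exact: iD|exact: iD].
  exact: (round_descent_le _ hxi hL hGmeas hGint hGmean hGvar hP hK hB hg n0 hL0 hc1 hc2).
have tot : gbar / 2 * q * \sum_(1 <= n < N.+1) a n <= F w1 - Fstar + N%:R * C.
  have : \sum_(1 <= n < N.+1) inner Pr (V n) (D n) <=
      \sum_(1 <= n < N.+1) (- (gbar / 2 * q) * a n + C).
    by rewrite big_seq [leRHS]big_seq; apply: ler_sum => n /memN; exact: round.
  rewrite big_split/= -mulr_sumr sumr_const_nat subSS subn0 -(mulr_natl C).
  by move: esum; lra.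
(* Multiplying by N (gbar / 2) q > 0 clears the denominators and turns both sides into exactly those
   of [tot]. *)
rewrite -(ler_pM2l (mulr_gt0 N0 (mulr_gt0 (divr_gt0 hg (ltr0Sn R 1)) q0))).
apply: (@le_trans _ _ (gbar / 2 * q * \sum_(1 <= n < N.+1) a n)).
  by rewrite le_eqVlt; apply/orP; left; apply/eqP; field; rewrite gt_eqF.
apply: (le_trans tot).
rewrite le_eqVlt; apply/orP; left; apply/eqP; rewrite /C; field.
by rewrite !gt_eqF.
Qed.
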